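(* The only limit point of $\lambda_{2,n}(1)$ is $1$, and the only limit point of $\lambda_{2,n}(2)$ is $3$; that is, $\{v:\lambda_{2,n}(1)=v\text{ for infinitely many odd } n>1\}=\{1\}$ and $\{v:\lambda_{2,n}(2)=v\text{ for infinitely many odd } n>1\}=\{3\}$.
   Context: For an odd integer $n>1$, a representation of a positive integer $k$ (with respect to $2$ and $n$) is an expression $k=\sum_{j\ge 0}\varepsilon_j(2)2^j+\sum_{j\ge 0}\varepsilon_j(n)n^j$ with only finitely many nonzero coefficients, where $\varepsilon_j(2)\in\{0,\pm1\}$ and $\varepsilon_j(n)\in\{0,\pm1,\dots,\pm\lfloor n/2\rfloor\}$ are integers. Its length is $\sum_{j\ge 0}(|\varepsilon_j(2)|+|\varepsilon_j(n)|)$. For a positive integer $h$, $\lambda_{2,n}(h)$ denotes the smallest positive integer that has a representation of length $h$ but no representation of length less than $h$. For fixed $h$, a limit point of $\lambda_{2,n}(h)$ is a value that $\lambda_{2,n}(h)$ takes for infinitely many $n$ as $n$ runs over the odd integers greater than $1$. *)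

(* Defs.v *)
From HB Require Import structures.
From mathcomp Require Import all_boot all_order all_algebra.
From mathcomp Require Import finmap.
From mathcomp Require Import boolp classical_sets cardinality.

Set Implicit Arguments.
Unset Strict Implicit.
Unset Printing Implicit Defensive.

Import Order.TTheory GRing.Theory Num.Theory.

Local Open Scope nat_scope.
Local Open Scope classical_set_scope.

(* Digit sequences (eps_j), j >= 0, with only finitely many nonzero terms. *)
Definition digits : Type := {fsfun nat -> int with 0%R}.

(* All digits lie in {0, +-1, ..., +-d}. *)
Definition digits_bounded (d : nat) (e : digits) : Prop :=
  forall j : nat, `|e j|%N <= d.

(* finsupp e contains exactly the j with e j != 0, so these two sums are the
   sums over all j >= 0. *)
Definition digits_value (b : nat) (e : digits) : int :=
  (\sum_(j <- finsupp e) e j * b%:Z ^+ j)%R.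

Definition digits_length (e : digits) : nat :=
  \sum_(j <- finsupp e) `|e j|%N.

Definition is_representation (n k : nat) (e2 en : digits) : Prop :=
  [/\ digits_bounded 1 e2,
      digits_bounded n./2 en &
      (k%:Z = digits_value 2 e2 + digits_value n en)%R].

Definition has_representation_of_length (n h k : nat) : Prop :=
  exists e2 en : digits,
    is_representation n k e2 en /\ digits_length e2 + digits_length en = h.

Definition has_minimal_length (n h k : nat) : Prop :=
  has_representation_of_length n h k /\
  forall l : nat, l < h -> ~ has_representation_of_length n l k.

(* lambda_{2,n}(h) = v, stated as a relation so that no junk value is needed
   should no positive integer have minimal length h. *)
Definition is_lambda (n h v : nat) : Prop :=
  [/\ 0 < v, has_minimal_length n h v &
      forall k : nat, 0 < k -> has_minimal_length n h k -> v <= k].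

Definition lambda_limit_points (h : nat) : set nat :=
  [set v | infinite_set [set n | [/\ odd n, 1 < n & is_lambda n h v]]].

(* Main.v *)
(** A digit sequence of length [l <= 1] in base [b] has value [0] or
    [+-b^j].  Hence the positive integers of minimal length at most [1] are
    the powers of [2] and of [n].  So [1] and [2] have minimal length [1],
    while [3 = 2^1 + n^0] has minimal length [2] as soon as [n > 3]. *)
Require Import Defs.
From mathcomp Require Import all_boot all_order all_algebra.
From mathcomp Require Import finmap.
From mathcomp Require Import boolp classical_sets cardinality.
From mathcomp Require Import zify.

Local Open Scope nat_scope.
Local Open Scope classical_set_scope.

Definition digits0 : digits := [fsfun for fun _ => 0%R]%fset.

Definition unit_digit (j : nat) : digits := [fsfun digits0 with j |-> 1%R].

Lemma finsupp_unit_digit j : finsupp (unit_digit j) = [fset j]%fset.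
Proof. by rewrite finsupp_with finsupp0 fsetU0. Qed.

Lemma digits_bounded0 d : digits_bounded d digits0.
Proof. by move=> j; rewrite fsfun0E. Qed.

Lemma digits_bounded_unit d j : 0 < d -> digits_bounded d (unit_digit j).
Proof.
by move=> d0 i; rewrite fsfun_withE; case: eqP => // _; rewrite fsfun0E.
Qed.

Lemma digits_value0 b : digits_value b digits0 = 0%R.
Proof. by rewrite /digits_value finsupp0 big_seq_fset0. Qed.

Lemma digits_value_unit b j : digits_value b (unit_digit j) = (b%:Z ^+ j)%R.
Proof.
by rewrite /digits_value finsupp_unit_digit big_seq_fset1 fsfun_with GRing.mul1r.
Qed.

Lemma digits_length0 : digits_length digits0 = 0.
Proof. by rewrite /digits_length finsupp0 big_seq_fset0. Qed.

Lemma digits_length_unit j : digits_length (unit_digit j) = 1.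
Proof.
by rewrite /digits_length finsupp_unit_digit big_seq_fset1 fsfun_with.
Qed.

(** Every index of the support carries a nonzero integer digit, so it contributes at least 1 to the
    length. *)
Lemma card_finsupp_le_length (e : digits) : #|` finsupp e| <= digits_length e.
Proof.
rewrite /digits_length -sum1_size big_seq [leqRHS]big_seq.
by apply: leq_sum => j; rewrite mem_finsupp absz_gt0.
Qed.

(** The support has at most one index. The factor [digits_length e] treats the zero sequence and a
    single digit uniformly; for the zero sequence any [j] serves. *)
Lemma digits_length_le1 (b : nat) (e : digits) : digits_length e <= 1 ->
  exists j, `|digits_value b e|%N = digits_length e * b ^ j.
Proof.
move=> /(leq_trans (card_finsupp_le_length e)).
rewrite /digits_value /digits_length leq_eqVlt ltnS leqn0 cardfs_eq0.
case/orP=> [/cardfs1P[j ->]|/eqP ->].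
  by exists j; rewrite !big_seq_fset1 abszM abszX.
by exists 0; rewrite !big_seq_fset0.
Qed.

Lemma has_representation_of_length0 (n k : nat) :
  has_representation_of_length n 0 k -> k = 0.
Proof.
move=> [e2 [en [[_ _ kE] /eqP]]]; rewrite addn_eq0 => /andP[/eqP l2 /eqP ln].
have [|i vi] := @digits_length_le1 2 e2; first by rewrite l2.
have [|j vj] := @digits_length_le1 n en; first by rewrite ln.
by rewrite l2 mul0n in vi; rewrite ln mul0n in vj; lia.
Qed.

Lemma has_representation_of_length1 (n k : nat) :
  has_representation_of_length n 1 k ->
  (exists j, k = 2 ^ j) \/ (exists j, k = n ^ j).
Proof.
move=> [e2 [en [[_ _ kE] l1]]].
have [|i vi] := @digits_length_le1 2 e2; first by rewrite -l1 leq_addr.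
have [|j vj] := @digits_length_le1 n en; first by rewrite -l1 leq_addl.
(* One of the two sequences has length 0, hence value 0; the other has value plus or minus a power,
   and [k] being a natural number fixes the sign. *)
case l2: (digits_length e2) l1 vi => [|m] l1 vi.
  by right; exists j; rewrite add0n in l1; rewrite l1 mul1n in vj; lia.
have [m0 ln] : m = 0 /\ digits_length en = 0 by lia.
by left; exists i; rewrite m0 mul1n in vi; rewrite ln mul0n in vj; lia.
Qed.

Lemma has_representation_pow2 (n j : nat) :
  has_representation_of_length n 1 (2 ^ j).
Proof.
exists (unit_digit j), digits0; split.
  split; [exact: digits_bounded_unit|exact: digits_bounded0|].
  by rewrite digits_value_unit digits_value0; lia.
by rewrite digits_length_unit digits_length0.
Qed.

Lemma has_representation_pow2D (n i j : nat) : 1 < n ->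
  has_representation_of_length n 2 (2 ^ i + n ^ j).
Proof.
move=> n1; exists (unit_digit i), (unit_digit j); split.
  split; [exact: digits_bounded_unit| |].
    by apply: digits_bounded_unit; rewrite half_gt0.
  by rewrite !digits_value_unit; lia.
by rewrite !digits_length_unit.
Qed.

Lemma is_lambda1 (n : nat) : is_lambda n 1 1.
Proof.
split=> //; split; first exact: (has_representation_pow2 n 0).
by case=> // _ /has_representation_of_length0.
Qed.

(** The bound on [n] excludes [n = 3], where 3 is itself a power of [n]. *)
Lemma is_lambda2 (n : nat) : 3 < n -> is_lambda n 2 3.
Proof.
move=> n3; split=> //.
  split; first by apply: (@has_representation_pow2D n 1 0); lia.
  case=> [_ /has_representation_of_length0//|[|//] _].
  (* With exponent 0 the power is 1. With a positive exponent, a power of 2 is even and a power of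
     [n] is at least [n > 3]. *)
  case/has_representation_of_length1=> -[[|j]] //; rewrite expnS => E; first lia.
  have : 0 < n ^ j by rewrite expn_gt0; lia.
  by nia.
case=> [|[|[|k]]] // _ [_ /(_ 1 isT)] [].
  exact: (has_representation_pow2 n 0).
exact: (has_representation_pow2 n 1).
Qed.

Lemma is_lambda_unique (n h v w : nat) :
  is_lambda n h v -> is_lambda n h w -> v = w.
Proof.
move=> [v0 hv minv] [w0 hw minw].
by apply/eqP; rewrite eqn_leq minv ?minw.
Qed.

Lemma infinite_odd_gt (m : nat) : infinite_set [set n | odd n /\ m < n].
Proof.
(* This map sends the set onto all of [nat]: [k] is the image of the odd number [2(k + m) + 1],
   which exceeds [m]. *)
move=> /(finite_image (fun n => n.-1./2 - m)) fin.
apply: infinite_nat; apply: sub_finite_set fin => k _.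
by exists (k + m).*2.+1; [split|]; rewrite /= ?odd_double// ?doubleK; lia.
Qed.

Lemma lambda_limit_points_eventually (m h v : nat) :
  (forall n, odd n -> m < n -> is_lambda n h v) ->
  lambda_limit_points h = [set v].
Proof.
move=> lam; apply/seteqP; split=> [w inf_w|_ ->].
  (* If [w] differs from [v], uniqueness leaves only the finitely many [n <= m] at which [w] can be
     attained. *)
  apply: contrapT => /= wv; apply: inf_w.
  apply: (@sub_finite_set _ _ `I_m.+1) => // n [on _ lw] /=.
  by rewrite ltnS leqNgt; apply/negP => /(lam n on)/(is_lambda_unique _ _ _ _ lw).
apply: sub_infinite_set (infinite_odd_gt (maxn 1 m)) => n [on].
by rewrite gtn_max => /andP[n1 mn]; split=> //; exact: lam.
Qed.

Theorem corollary1 :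
  lambda_limit_points 1 = [set 1%N] /\ lambda_limit_points 2 = [set 3%N].
Proof.
split; first by apply: (@lambda_limit_points_eventually 0) => n _ _; exact: is_lambda1.
by apply: (@lambda_limit_points_eventually 3) => n _; exact: is_lambda2.
Qed.
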